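(* Let $I\subset\mathbb{R}$ be an open interval and let $\alpha: I\to E^3$ be a smooth unit speed curve with nowhere zero curvature $\kappa$ and nowhere zero torsion $\tau$. Let $\widetilde{T}$ be the spherical tangent indicatrix of $\alpha$ and let $\{T_1,N_1,B_1\}$ be the Frenet frame of the curve $\widetilde{T}$. Then $\alpha$ is a slant helix if and only if $$\frac{\|D_{T_1}B_1\|}{\|D_{T_1}T_1\|}$$ is constant along the curve.
   Context: $E^3$ is Euclidean 3-space. For a unit speed curve $\alpha$ with Frenet vectors $T_\alpha=\alpha'$, $N_\alpha=T_\alpha'/\|T_\alpha'\|$, $B_\alpha=T_\alpha\times N_\alpha$, the curvature $\kappa$ and torsion $\tau$ are given by $T_\alpha'=\kappa N_\alpha$, $N_\alpha'=-\kappa T_\alpha+\tau B_\alpha$, $B_\alpha'=-\tau N_\alpha$. The (spherical) tangent indicatrix of $\alpha$ is the curve $\widetilde{T}(s)=T_\alpha(s)$ on the unit sphere centred at the origin. Its Frenet frame $\{T_1,N_1,B_1\}$ consists of its unit tangent, principal normal and binormal as a curve in $E^3$, and $D_{T_1}$ denotes differentiation along the curve $\widetilde{T}$ in the direction of its unit tangent (i.e. with respect to its own arclength). A curve with nonvanishing curvature is a slant helix if its principal normal makes a constant angle with some fixed direction; equivalently, the function $\sigma=\frac{\kappa^2}{(\kappa^2+\tau^2)^{3/2}}\left(\frac{\tau}{\kappa}\right)'$ is constant. *)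

(* Defs.v *)
From HB Require Import structures.
From mathcomp Require Import all_boot all_order all_algebra.
From mathcomp Require Import all_classical all_reals all_analysis.

Set Implicit Arguments.
Unset Strict Implicit.
Unset Printing Implicit Defensive.

Import Order.TTheory GRing.Theory Num.Theory.
Import numFieldNormedType.Exports.

Local Open Scope classical_set_scope.
Local Open Scope ring_scope.

Section Euclidean3.
Variable R : realType.
Implicit Types u v : 'rV[R]_3.

Definition dotv u v : R := \sum_(i < 3) u 0 i * v 0 i.

(* The library norm `|u| on 'rV[R]_3 is the sup norm; it only serves to define
   derivatives, which do not depend on the choice of a norm. *)
Definition enorm u : R := Num.sqrt (dotv u u).

(* Indices are computed in 'I_3, i.e. modulo 3. *)
Definition crossv u v : 'rV[R]_3 :=
  \row_(k < 3) (u 0 (k + 1) * v 0 (k + 2) - u 0 (k + 2) * v 0 (k + 1)).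

Definition angle u v : R := acos (dotv u v / (enorm u * enorm v)).

End Euclidean3.

(* Curves are total functions, only ever considered on an open set I; the
   values of the notions below at points of I depend only on the curve on I. *)
Section Curves.
Variable R : realType.
Implicit Types (I : set R) (c X : R -> 'rV[R]_3) (s : R).

Definition smooth_on I c : Prop :=
  forall (n : nat) s, I s -> derivable (derive1n n c) s 1.

Definition unit_speed_on I c : Prop :=
  forall s, I s -> enorm (derive1 c s) = 1.

(* Derivative of a vector field X along the regular curve c, in the direction
   of the unit tangent of c: with l the arclength of c, d/dl = |c'|^-1 d/ds. *)
Definition arcD c X : R -> 'rV[R]_3 :=
  fun s => (enorm (derive1 c s))^-1 *: derive1 X s.

Definition tangent c : R -> 'rV[R]_3 := arcD c c.

Definition curvature c : R -> R := fun s => enorm (arcD c (tangent c) s).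

Definition pnormal c : R -> 'rV[R]_3 :=
  fun s => (curvature c s)^-1 *: arcD c (tangent c) s.

Definition binormal c : R -> 'rV[R]_3 :=
  fun s => crossv (tangent c s) (pnormal c s).

(* The B-component of the Frenet formula N' = - kappa T + tau B. *)
Definition torsion c : R -> R :=
  fun s => dotv (arcD c (pnormal c) s) (binormal c s).

Lemma arcD_unit_speed I c X s :
  unit_speed_on I c -> I s -> arcD c X s = derive1 X s.
Proof. by move=> c1 Is; rewrite /arcD c1// invr1 scale1r. Qed.

(* The indicatrix keeps the parameter of c, so its speed is the curvature of c. *)
Definition tangent_indicatrix c : R -> 'rV[R]_3 := tangent c.

Definition slant_helix I c : Prop :=
  (forall s, I s -> curvature c s != 0) /\
  exists u : 'rV[R]_3, u != 0 /\
    exists theta : R, forall s, I s -> angle (pnormal c s) u = theta.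

Definition constant_on I (f : R -> R) : Prop :=
  exists k : R, forall s, I s -> f s = k.

End Curves.

(* Main.v *)
Require Import Defs.
From mathcomp Require Import all_boot all_order all_algebra.
From mathcomp Require Import all_classical all_reals all_analysis.
From mathcomp Require Import ring lra.
Set Implicit Arguments.
Unset Strict Implicit.
Unset Printing Implicit Defensive.

Import Order.TTheory GRing.Theory Num.Theory.
Import numFieldNormedType.Exports.
Local Open Scope classical_set_scope.
Local Open Scope ring_scope.

(** Write f = tau/kappa and w = (1 + f^2)^(1/2). The indicatrix has speed kappa,
    so its tangent is N and, by the Frenet formulas, D T1 = - T + f B, of norm
    w. Hence its binormal is B1 = (f T + B)/w, and differentiating once more
    gives D B1 = sigma (T - f B) with sigma = f'/(kappa w^3), again along a
    vector of norm w. The quotient of the statement is therefore |sigma|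
    ([ratio_slant_sigma]), and it remains to see that the curve is a slant helix
    if and only if |sigma| is constant.

    If N.u = a is constant for a nonzero vector u, differentiating twice
    determines the components of u in the Frenet frame and leads to
    sigma^2 = a^2 / (|u|^2 - a^2) ([slant_of_constant_projection]).

    Conversely, sigma is continuous, so on an interval it is constant as soon as
    |sigma| is ([cst_of_cst_norm]). If sigma = m, then D B1 + m D N = 0, so
    B1 + m N is a fixed vector, and N makes a constant angle with it
    ([sigma_cst_slant_helix]). *)

(** * Vector algebra in Euclidean 3-space *)

Lemma dotvE (R : realType) (u v : 'rV[R]_3) :
  dotv u v = u 0 0 * v 0 0 + u 0 1 * v 0 1 + u 0 2 * v 0 2.
Proof.
rewrite /dotv !big_ord_recl big_ord0 addr0 addrA.
by do ?congr (_ + _); congr (_ * _); congr (_ _ _); apply: val_inj.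
Qed.

Lemma crossvE (R : realType) (u v : 'rV[R]_3) :
  (crossv u v 0 0 = u 0 1 * v 0 2 - u 0 2 * v 0 1) *
  (crossv u v 0 1 = u 0 2 * v 0 0 - u 0 0 * v 0 2) *
  (crossv u v 0 2 = u 0 0 * v 0 1 - u 0 1 * v 0 0).
Proof.
by rewrite /crossv !mxE; split; first split;
   congr (u 0 _ * v 0 _ - u 0 _ * v 0 _); apply: val_inj.
Qed.

Lemma row3P (R : realType) (u v : 'rV[R]_3) :
  u 0 0 = v 0 0 -> u 0 1 = v 0 1 -> u 0 2 = v 0 2 -> u = v.
Proof.
move=> e0 e1 e2; apply/rowP => -[[|[|[|//]]] i3].
- by rewrite (_ : Ordinal _ = 0) //; apply: val_inj.
- by rewrite (_ : Ordinal _ = 1) //; apply: val_inj.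
- by rewrite (_ : Ordinal _ = 2) //; apply: val_inj.
Qed.

Lemma dotvC (R : realType) (u v : 'rV[R]_3) : dotv u v = dotv v u.
Proof. by rewrite !dotvE; ring. Qed.

Lemma dotvDl (R : realType) (u v w : 'rV[R]_3) :
  dotv (u + v) w = dotv u w + dotv v w.
Proof. by rewrite !dotvE !mxE; ring. Qed.

Lemma dotvZl (R : realType) (a : R) (u v : 'rV[R]_3) :
  dotv (a *: u) v = a * dotv u v.
Proof. by rewrite !dotvE !mxE; ring. Qed.

Lemma dotv_comb2 (R : realType) (a b a' b' : R) (u v : 'rV[R]_3) :
  dotv (a *: u + b *: v) (a' *: u + b' *: v) =
  a * a' * dotv u u + (a * b' + b * a') * dotv u v + b * b' * dotv v v.
Proof. by rewrite !dotvE !mxE; ring. Qed.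

Lemma crossvZr (R : realType) (a : R) (u v : 'rV[R]_3) :
  crossv u (a *: v) = a *: crossv u v.
Proof.
have [[]] := crossvE u v; move: (crossv u v) => w w0 w1 w2.
by apply: row3P; rewrite !crossvE !mxE ?w0 ?w1 ?w2; ring.
Qed.

Lemma crossvZv (R : realType) (a : R) (u : 'rV[R]_3) : crossv (a *: u) u = 0.
Proof. by apply: row3P; rewrite !crossvE !mxE; ring. Qed.

(** The double product u x (u x v) = (u.v) u - (u.u) v; it gives the normal
    component of B' in the Frenet formulas. *)
Lemma crossv_crossv (R : realType) (a b : R) (u v : 'rV[R]_3) :
  crossv u (a *: u + b *: crossv u v) = b *: (dotv u v *: u - dotv u u *: v).
Proof.
have [[]] := crossvE u v; move: (crossv u v) => w w0 w1 w2.
by apply: row3P; rewrite !crossvE !mxE ?w0 ?w1 ?w2 !dotvE; ring.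
Qed.

(** The double product v x (u x v) = (v.v) u - (u.v) v; it gives the binormal
    of the indicatrix, whose tangent is N. *)
Lemma crossv_crossv_right (R : realType) (a b : R) (u v : 'rV[R]_3) :
  crossv v (a *: u + b *: crossv u v) =
  - a *: crossv u v + b *: (dotv v v *: u - dotv u v *: v).
Proof.
have := crossvE v (a *: u + b *: crossv u v); have [[]] := crossvE u v.
move: (crossv u v) => w w0 w1 w2; move: (crossv v _) => z [[z0 z1] z2].
by apply: row3P; rewrite ?z0 ?z1 ?z2 !mxE ?w0 ?w1 ?w2 !dotvE; ring.
Qed.

Lemma lagrange_identity (R : realType) (u v : 'rV[R]_3) :
  dotv (crossv u v) (crossv u v) = dotv u u * dotv v v - dotv u v ^+ 2.
Proof. by rewrite !dotvE !crossvE; ring. Qed.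

(** A polynomial identity, valid for all u and v, expresses |u x v|^2 w through
    u, v and u x v; orthonormality only simplifies its coefficients. *)
Lemma frame_decomp (R : realType) (u v w : 'rV[R]_3) :
  dotv u u = 1 -> dotv v v = 1 -> dotv u v = 0 ->
  w = dotv w u *: u + dotv w v *: v + dotv w (crossv u v) *: crossv u v.
Proof.
move=> uu vv uv.
have key : (dotv u u * dotv v v - dotv u v ^+ 2) *: w =
  (dotv w u * dotv v v - dotv w v * dotv u v) *: u +
  (dotv w v * dotv u u - dotv w u * dotv u v) *: v +
  dotv w (crossv u v) *: crossv u v.
  have [[]] := crossvE u v; move: (crossv u v) => b b0 b1 b2.
  by apply: row3P; rewrite !mxE !dotvE b0 b1 b2; ring.
by move: key; rewrite uu vv uv expr0n /= subr0 !mulr1 !mulr0 !subr0 scale1r.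
Qed.

Lemma frame_parseval (R : realType) (u v w : 'rV[R]_3) :
  dotv u u = 1 -> dotv v v = 1 -> dotv u v = 0 ->
  dotv w w = dotv w u ^+ 2 + dotv w v ^+ 2 + dotv w (crossv u v) ^+ 2.
Proof.
move=> uu vv uv; have := frame_decomp w uu vv uv; move: (crossv u v) => z E.
by rewrite {1}E !dotvDl !dotvZl !(dotvC _ w) -!expr2.
Qed.

Lemma enorm_sqr (R : realType) (u : 'rV[R]_3) : enorm u ^+ 2 = dotv u u.
Proof.
by rewrite sqr_sqrtr // dotvE -!expr2 !addr_ge0 ?sqr_ge0.
Qed.

Lemma enormZ (R : realType) (a : R) (u : 'rV[R]_3) :
  enorm (a *: u) = `|a| * enorm u.
Proof.
rewrite /enorm dotvZl dotvC dotvZl mulrA -expr2 sqrtrM ?sqr_ge0 //.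
by rewrite sqrtr_sqr.
Qed.

Lemma enorm_eq0 (R : realType) (u : 'rV[R]_3) : (enorm u == 0) = (u == 0).
Proof.
apply/eqP/eqP => [u0|->]; last first.
  by rewrite /enorm dotvE !mxE !mulr0 !addr0 sqrtr0.
have /eqP : dotv u u = 0 by rewrite -enorm_sqr u0 expr0n.
rewrite dotvE -!expr2 !paddr_eq0 ?addr_ge0 ?sqr_ge0 // !sqrf_eq0.
by move=> /andP[/andP[/eqP a /eqP b] /eqP c]; apply: row3P; rewrite mxE.
Qed.

(** The cosine undoes the arc cosine because the Lagrange identity gives the
    Cauchy-Schwarz inequality. *)
Lemma angle_cos (R : realType) (u v : 'rV[R]_3) :
  dotv u v = enorm u * enorm v * cos (angle u v).
Proof.
have CS : dotv u v ^+ 2 <= dotv u u * dotv v v.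
  by rewrite -subr_ge0 -lagrange_identity -enorm_sqr sqr_ge0.
have [z|nz] := eqVneq (enorm u * enorm v) 0.
  have : dotv u v ^+ 2 <= 0.
    by rewrite (le_trans CS) // -!enorm_sqr -exprMn z expr0n.
  by rewrite z mul0r => h; apply/eqP; rewrite -sqrf_eq0 eq_le h sqr_ge0.
rewrite /angle acosK; first by rewrite mulrC divfK.
have p : 0 < enorm u * enorm v by rewrite lt_neqAle eq_sym nz mulr_ge0 ?sqrtr_ge0.
rewrite in_itv /= -ler_norml -ler_sqr ?nnegrE // expr1n real_normK ?num_real // expr_div_n.
by rewrite ler_pdivrMr ?exprn_gt0 // mul1r exprMn !enorm_sqr.
Qed.

(** * Calculus of vector-valued functions on an open interval *)

Lemma is_derive_mxP (R : realType) (m n : nat) (M : R -> 'M[R]_(m, n)) (t : R) dM :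
  is_derive t 1 M dM <-> forall i j, is_derive t 1 (fun x => M x i j) (dM i j).
Proof.
split=> [[Mt <-] i j|Mt].
  by split; [move/derivable_mxP : Mt; exact | rewrite derive_mx// mxE].
have dM' : derivable M t 1 by apply/derivable_mxP => i j; have [] := Mt i j.
split=> //; rewrite derive_mx//; apply/matrixP => i j; rewrite mxE.
by have [_ ->] := Mt i j.
Qed.

Lemma is_derive_dotv (R : realType) (X Y : R -> 'rV[R]_3) (s : R) dX dY :
  is_derive s 1 X dX -> is_derive s 1 Y dY ->
  is_derive s 1 (fun t => dotv (X t) (Y t)) (dotv dX (Y s) + dotv (X s) dY).
Proof.
move=> /is_derive_mxP dXs /is_derive_mxP dYs.
rewrite (_ : (fun t => _) = \sum_(i < 3) ((fun t => X t 0 i) * (fun t => Y t 0 i))); last first.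
  by apply/funext => t; rewrite fct_sumE.
apply: is_derive_eq.
rewrite /dotv -big_split /=; apply: eq_bigr => i _.
by rewrite addrC; congr (_ + _); rewrite /GRing.scale /= mulrC.
Qed.

Lemma is_derive_dotvl (R : realType) (X : R -> 'rV[R]_3) (u : 'rV[R]_3) (s : R) dX :
  is_derive s 1 X dX -> is_derive s 1 (fun x => dotv (X x) u) (dotv dX u).
Proof.
move=> dXs; have := is_derive_dotv dXs (is_derive_cst u s 1); congr is_derive.
have -> : dotv (X s) 0 = 0 by rewrite dotvE !mxE !mulr0 !addr0.
by rewrite addr0.
Qed.

Lemma is_derive_crossv (R : realType) (X Y : R -> 'rV[R]_3) (s : R) dX dY :
  is_derive s 1 X dX -> is_derive s 1 Y dY ->
  is_derive s 1 (fun t => crossv (X t) (Y t)) (crossv dX (Y s) + crossv (X s) dY).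
Proof.
move=> /is_derive_mxP dXs /is_derive_mxP dYs; apply/is_derive_mxP => i j.
rewrite (ord1 i) !mxE.
rewrite (_ : (fun t => _) = (fun t => X t 0 (j + 1)) * (fun t => Y t 0 (j + 2)) -
   (fun t => X t 0 (j + 2)) * (fun t => Y t 0 (j + 1))); last first.
  by apply/funext => t; rewrite mxE.
apply: is_derive_eq; rewrite /GRing.scale /=; ring.
Qed.

Lemma is_derive_scale (R : realType) (g : R -> R) (X : R -> 'rV[R]_3) (s dg : R) dX :
  is_derive s 1 g dg -> is_derive s 1 X dX ->
  is_derive s 1 (fun t => g t *: X t) (dg *: X s + g s *: dX).
Proof.
move=> dgs /is_derive_mxP dXs; apply/is_derive_mxP => i j.
rewrite !mxE.
rewrite (_ : (fun t => _) = g * (fun t => X t i j)); last first.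
  by apply/funext => t; rewrite mxE.
apply: is_derive_eq; rewrite /GRing.scale /=; ring.
Qed.

Lemma is_derive_continuous (R : realType) (f : R -> R) (s df : R) :
  is_derive s 1 f df -> {for s, continuous f}.
Proof. by case=> fs _; apply/differentiable_continuous/derivable1_diffP. Qed.

(** Derivatives are local: identities between vector fields that hold only on an
    open set I can still be differentiated there. *)
Lemma eq_on_is_derive (R : realType) (V : normedModType R) (I : set R)
    (f g : R -> V) (s : R) (df : V) :
  open I -> I s -> (forall x, I x -> f x = g x) ->
  is_derive s 1 f df -> is_derive s 1 g df.
Proof.
move=> Io Is fg; apply: near_eq_is_derive.
by apply: filterS (open_nbhs_nbhs (conj Io Is)).
Qed.

Lemma derive1_val (R : realType) (V : normedModType R) (f : R -> V) (s : R) df :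
  is_derive s 1 f df -> derive1 f s = df.
Proof. by rewrite derive1E; case. Qed.

Lemma cst_on_interval (R : realType) (I : set R) (X : R -> 'rV[R]_3) :
  is_interval I -> (forall s, I s -> is_derive s 1 X 0) ->
  forall s t, I s -> I t -> X s = X t.
Proof.
move=> Iitv X0 s t.
wlog st : s t / s <= t.
  by move=> H Is It; case: (leP s t) => [/H|/ltW /H H']; [exact | rewrite H'].
move=> Is It.
have sub x : x \in `[s, t] -> I x by rewrite in_itv /= => /(Iitv _ _ Is It).
have dX x : x \in `[s, t] -> forall j, is_derive x 1 (fun y => X y 0 j) 0.
  by move=> /sub /X0 /is_derive_mxP H j; have := H 0 j; rewrite mxE.
apply/rowP => j; apply/esym/eqP; rewrite -subr_eq0.
have [||c _ ->] := @MVT_segment R (fun y => X y 0 j) (fun=> 0) s t st.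
- by move=> x /subset_itv_oo_cc /dX /(_ j).
- by apply: derivable_within_continuous => x /dX /(_ j) [].
- by rewrite mul0r.
Qed.

(** Were g to take two values of opposite signs, it would vanish in between,
    and then the constant norm would be 0. *)
Lemma cst_of_cst_norm (R : realType) (I : set R) (g : R -> R) (k : R) :
  is_interval I -> (forall s, I s -> {for s, continuous g}) ->
  (forall s, I s -> `|g s| = k) ->
  forall s t, I s -> I t -> g s = g t.
Proof.
move=> Iitv gc gk s t.
wlog st : s t / s <= t.
  by move=> H Is It; case: (leP s t) => [/H|/ltW /H H']; [exact | rewrite H'].
move=> Is It.
have sub x : x \in `[s, t] -> I x by rewrite in_itv /= => /(Iitv _ _ Is It).
have : `|g s| = `|g t| by rewrite !gk.
move=> /eqP; rewrite eqr_norm2 => /orP[/eqP //|/eqP gst].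
have gw : {within `[s, t], continuous g}.
  by apply: continuous_in_subspaceT => x; rewrite inE => /= /sub /gc.
have [|c /sub Ic gc0] := @IVT R g s t 0 st gw.
  rewrite gst; case: (leP 0 (g t)) => h; rewrite ge_min le_max.
    by rewrite oppr_le0 h orbT.
  by rewrite (ltW h) oppr_ge0 (ltW h) orbT.
have := gk _ Ic; rewrite gc0 normr0 => k0.
have z x : I x -> g x = 0 by move=> /gk; rewrite -k0 => /normr0_eq0.
by rewrite !z.
Qed.

(** * The Frenet formulas of a unit speed curve *)

Section Frenet.
Variables (R : realType) (I : set R) (c : R -> 'rV[R]_3).
Hypothesis I_open : open I.
Hypothesis c_smooth : smooth_on I c.
Hypothesis c_unit : unit_speed_on I c.
Hypothesis k_neq0 : forall s, I s -> curvature c s != 0.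

Local Notation T := (tangent c).
Local Notation N := (pnormal c).
Local Notation B := (binormal c).
Local Notation k := (curvature c).
Local Notation t := (torsion c).

Lemma is_derive_derive1n n s :
  I s -> is_derive s 1 (derive1n n c) (derive1n n.+1 c s).
Proof.
by move=> Is; rewrite derive1nS derive1E; apply/derivableP/c_smooth.
Qed.
Arguments is_derive_derive1n n [s] _.

Lemma tangentE s : I s -> T s = derive1n 1 c s.
Proof. by move=> Is; rewrite /tangent (arcD_unit_speed _ c_unit Is) derive1n1. Qed.

Lemma is_derive_tangent2 s : I s -> is_derive s 1 T (derive1n 2 c s).
Proof.
move=> Is; apply: (eq_on_is_derive I_open Is _ (is_derive_derive1n 1 Is)).
by move=> x Ix; rewrite tangentE.
Qed.

Lemma curvatureE s : I s -> k s = enorm (derive1n 2 c s).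
Proof.
move=> Is; rewrite /curvature (arcD_unit_speed _ c_unit Is).
by rewrite (derive1_val (is_derive_tangent2 Is)).
Qed.

Lemma curvature_gt0 s : I s -> 0 < k s.
Proof. by move=> Is; rewrite lt_neqAle eq_sym k_neq0 //= curvatureE ?sqrtr_ge0. Qed.

Lemma derive2_pnormal s : I s -> derive1n 2 c s = k s *: N s.
Proof.
move=> Is; rewrite /pnormal scalerA divff ?k_neq0 // scale1r.
by rewrite (arcD_unit_speed _ c_unit Is) (derive1_val (is_derive_tangent2 Is)).
Qed.

Lemma is_derive_tangent s : I s -> is_derive s 1 T (k s *: N s).
Proof. by move=> Is; rewrite -derive2_pnormal //; exact: is_derive_tangent2. Qed.

Lemma dotv_TT s : I s -> dotv (T s) (T s) = 1.
Proof. by move=> Is; rewrite -enorm_sqr tangentE // derive1n1 c_unit // expr1n. Qed.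

Lemma dotv_NN s : I s -> dotv (N s) (N s) = 1.
Proof.
move=> Is; have k0 := k_neq0 Is.
have : dotv (derive1n 2 c s) (derive1n 2 c s) = k s ^+ 2 by rewrite curvatureE // enorm_sqr.
rewrite derive2_pnormal // dotvZl dotvC dotvZl mulrA -expr2 => /(congr1 ( *%R (k s ^- 2))).
by rewrite mulrA mulVf ?mul1r // expf_neq0.
Qed.

Lemma is_derive_cst_on (f : R -> R) (a s df : R) :
  I s -> (forall x, I x -> f x = a) -> is_derive s 1 f df -> df = 0.
Proof.
move=> Is fa /(eq_on_is_derive I_open Is fa) [_ <-].
by rewrite (_ : (fun _ => a) = cst a) // derive_cst.
Qed.

(** Differentiate T.T = 1. *)
Lemma dotv_TN s : I s -> dotv (T s) (N s) = 0.
Proof.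
move=> Is; have dT := is_derive_tangent Is.
have := is_derive_cst_on Is dotv_TT (is_derive_dotv dT dT).
rewrite [dotv (T s) _]dotvC -mulr2n => /eqP; rewrite mulrn_eq0 /= dotvZl mulf_eq0.
by rewrite (negbTE (k_neq0 Is)) dotvC => /eqP.
Qed.

Lemma dotv_BB s : I s -> dotv (B s) (B s) = 1.
Proof.
move=> Is; rewrite /binormal lagrange_identity.
by rewrite dotv_TT // dotv_NN // dotv_TN // expr0n mulr1 subr0.
Qed.

Lemma dotv_TB s : dotv (T s) (B s) = 0.
Proof. by rewrite /binormal !dotvE !crossvE; ring. Qed.

Lemma dotv_NB s : dotv (N s) (B s) = 0.
Proof. by rewrite /binormal !dotvE !crossvE; ring. Qed.

Lemma is_derive_curvature s :
  I s -> is_derive s 1 k (dotv (N s) (derive1n 3 c s)).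
Proof.
move=> Is; have k0 := curvature_gt0 Is.
apply: (@eq_on_is_derive _ _ I (Num.sqrt \o (fun x => dotv (derive1n 2 c x) (derive1n 2 c x)))) => //.
  by move=> x Ix; rewrite curvatureE.
have := is_derive_derive1n 2 Is; move: (derive1n 3 c s) => c3 d2.
have d := is_derive_dotv d2 d2.
have p : 0 < dotv (derive1n 2 c s) (derive1n 2 c s).
  by rewrite -enorm_sqr -curvatureE // exprn_gt0.
have ds := is_derive1_sqrt p.
apply: is_derive_eq; rewrite -(curvatureE Is : k s = Num.sqrt (dotv _ _)).
rewrite (dotvC c3) derive2_pnormal // dotvZl.
by move: (dotv _ c3) (k s) k0 => a b b0; field; rewrite gt_eqF.
Qed.

(** The coefficient a is (1/kappa)' kappa; it is left unspecified because
    N' has no component on N. *)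
Lemma is_derive_pnormal1 s : I s ->
  exists a, is_derive s 1 N (a *: N s + (k s)^-1 *: derive1n 3 c s).
Proof.
move=> Is; have k0 := k_neq0 Is.
have dV := is_deriveV k0 (is_derive_curvature Is).
have := is_derive_scale dV (is_derive_derive1n 2 Is).
rewrite derive2_pnormal // scalerA.
set a := (X in X *: N s) => d; exists a.
apply: (eq_on_is_derive I_open Is _ d) => x Ix.
by rewrite derive2_pnormal // scalerA mulVf ?k_neq0 ?scale1r.
Qed.

(** Differentiating N.N = 1 and T.N = 0 gives the components of N' on N and T;
    its component on B is the torsion by definition. *)
Lemma is_derive_pnormal s :
  I s -> is_derive s 1 N (- k s *: T s + t s *: B s).
Proof.
move=> Is; have [a] := is_derive_pnormal1 Is; move: (a *: _ + _) => dNs dN.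
have tE : t s = dotv dNs (B s).
  by rewrite /torsion (arcD_unit_speed _ c_unit Is) (derive1_val dN).
have dNN : dotv dNs (N s) = 0.
  have := is_derive_cst_on Is dotv_NN (is_derive_dotv dN dN).
  by rewrite [dotv (N s) _]dotvC -mulr2n => /eqP; rewrite mulrn_eq0 /= => /eqP.
have dNT : dotv dNs (T s) = - k s.
  have := is_derive_cst_on Is dotv_TN (is_derive_dotv (is_derive_tangent Is) dN).
  rewrite dotvZl dotv_NN // mulr1 dotvC => /eqP; rewrite addrC addr_eq0.
  by move=> /eqP.
rewrite -dNT tE; move: dN; congr is_derive.
have := frame_decomp dNs (dotv_TT Is) (dotv_NN Is) (dotv_TN Is).
by rewrite dNN scale0r addr0.
Qed.

Lemma is_derive_binormal s : I s -> is_derive s 1 B (- t s *: N s).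
Proof.
move=> Is.
have := is_derive_crossv (is_derive_tangent Is) (is_derive_pnormal Is).
congr is_derive.
rewrite crossvZv add0r crossv_crossv dotv_TN // dotv_TT //.
by rewrite scale0r sub0r scale1r scalerN scaleNr.
Qed.

(** This expression shows that the torsion is differentiable: unlike the
    definition, it mentions no derivative of N. *)
Lemma torsionE s : I s -> t s = (k s)^-1 * dotv (derive1n 3 c s) (B s).
Proof.
move=> Is; have [a dN] := is_derive_pnormal1 Is.
rewrite /torsion (arcD_unit_speed _ c_unit Is) (derive1_val dN) dotvDl (dotvZl a).
by rewrite dotv_NB mulr0 add0r dotvZl.
Qed.

(** * The function sigma *)

Definition harmonic_curvature x := t x / k x.

(** With h = 1/kappa, g = alpha'''.B, n = N.alpha''' and q = alpha''''.B one
    has tau/kappa = h^2 g and (tau/kappa)' = h^2 q - 3 h^3 n g, in which every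
    factor is differentiable. *)
Lemma harmonic_curvature_C1 s : I s ->
  is_derive s 1 harmonic_curvature (derive1 harmonic_curvature s) /\
  {for s, continuous (derive1 harmonic_curvature)}.
Proof.
(* These are the only properties of the third and fourth derivatives that
   matter. *)
have [c3 [c4 [dk tE d3 d4]]] : exists c3 c4 : R -> 'rV[R]_3, [/\
    forall x, I x -> is_derive x 1 k (dotv (N x) (c3 x)),
    forall x, I x -> t x = (k x)^-1 * dotv (c3 x) (B x),
    forall x, I x -> is_derive x 1 c3 (c4 x) &
    forall x, I x -> is_derive x 1 c4 (derive1n 5 c x)].
  exists (derive1n 3 c), (derive1n 4 c); split => x Ix.
  - exact: is_derive_curvature.
  - exact: torsionE.
  - exact: is_derive_derive1n.
  - exact: is_derive_derive1n.
pose h x := (k x)^-1; pose g x := dotv (c3 x) (B x).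
pose n x := dotv (N x) (c3 x); pose q x := dotv (c4 x) (B x).
have dh (x : R) (Ix : I x) : is_derive x 1 h _ := is_deriveV (k_neq0 Ix) (dk x Ix).
have dg (x : R) (Ix : I x) : is_derive x 1 g _ :=
  is_derive_dotv (d3 x Ix) (is_derive_binormal Ix).
have dn (x : R) (Ix : I x) : is_derive x 1 n _ :=
  is_derive_dotv (is_derive_pnormal Ix) (d3 x Ix).
have dq (x : R) (Ix : I x) : is_derive x 1 q _ :=
  is_derive_dotv (d4 x Ix) (is_derive_binormal Ix).
pose df := h ^+ 2 * q - cst 3 * h ^+ 3 * n * g.
have df_val x : I x -> is_derive x 1 harmonic_curvature (df x).
  move=> Ix; have dhx := dh x Ix; have dgx := dg x Ix; have k0 := k_neq0 Ix.
  have d : is_derive x 1 (h ^+ 2 * g) (df x).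
    apply: is_derive_eq.
    rewrite [dotv (c3 x) (_ *: _)]dotvC dotvZl tE // -/(g x) -/(q x) -/(n x).
    rewrite /df !fctE /h /GRing.scale /=.
    by move: (g x) (q x) (n x) (k x) k0 => g' q' n' k' k0; field.
  apply: (eq_on_is_derive I_open Ix _ d) => y Iy.
  rewrite -[LHS]/((h y * h y) * g y).
  by rewrite /harmonic_curvature tE // -mulrA mulrC.
move=> Is; split; first by rewrite (derive1_val (df_val _ Is)); exact: df_val.
have dhs := dh s Is; have dgs := dg s Is; have dns := dn s Is; have dqs := dq s Is.
have ddf := is_deriveB (is_deriveM (is_deriveX 2 dhs) dqs)
  (is_deriveM (is_deriveM (is_deriveM (is_derive_cst (3 : R) s 1) (is_deriveX 3 dhs)) dns) dgs).
apply: is_derive_continuous.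
apply: (eq_on_is_derive I_open Is _ ddf) => x Ix.
by rewrite (derive1_val (df_val _ Ix)).
Qed.

Definition indicatrix_curvature x := Num.sqrt (1 + harmonic_curvature x ^+ 2).
Local Notation f := harmonic_curvature.
Local Notation w := indicatrix_curvature.

Lemma indicatrix_curvature_gt0 x : 0 < w x.
Proof. by rewrite sqrtr_gt0 ltr_pwDl // sqr_ge0. Qed.

Lemma indicatrix_curvature_sqr x : w x ^+ 2 = 1 + f x ^+ 2.
Proof. by rewrite sqr_sqrtr // addr_ge0 // sqr_ge0. Qed.

Lemma is_derive_indicatrix_curvature s : I s ->
  is_derive s 1 w (f s * derive1 f s / w s).
Proof.
move=> Is; have [df _] := harmonic_curvature_C1 Is.
have d1 := is_deriveD (is_derive_cst (1 : R) s 1) (is_deriveX 2 df).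
have p : 0 < (cst 1 + f ^+ 2) s by rewrite /= ltr_pwDl // sqr_ge0.
have d2 := is_derive1_comp (is_derive1_sqrt p) d1.
have w0 := indicatrix_curvature_gt0 s.
apply: (is_derive_eq d2); rewrite -[Num.sqrt _]/(w s) /GRing.scale /=.
by move: (w s) w0 => w' w0; field; rewrite gt_eqF.
Qed.

(** The function sigma of the slant helix criterion:
    kappa^2 (kappa^2 + tau^2)^(-3/2) (tau/kappa)', written with f = tau/kappa
    and w = (1 + f^2)^(1/2) = (kappa^2 + tau^2)^(1/2) / kappa. *)
Definition slant_sigma x := derive1 f x / (k x * w x ^+ 3).
Local Notation sigma := slant_sigma.

Lemma continuous_slant_sigma s : I s -> {for s, continuous sigma}.
Proof.
move=> Is; apply: continuousM; first by have [] := harmonic_curvature_C1 Is.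
have k0 := curvature_gt0 Is; have w0 := indicatrix_curvature_gt0 s.
apply: continuousV; first by rewrite mulf_neq0 ?expf_neq0 ?gt_eqF.
exact: is_derive_continuous
  (is_deriveM (is_derive_curvature Is) (is_deriveX 3 (is_derive_indicatrix_curvature Is))).
Qed.

Lemma enorm_N s : I s -> enorm (N s) = 1.
Proof. by move=> Is; rewrite /enorm dotv_NN // sqrtr1. Qed.

(** * The Frenet frame of the tangent indicatrix *)

Lemma indicatrix_speed s : I s -> enorm (derive1 T s) = k s.
Proof.
move=> Is; rewrite (derive1_val (is_derive_tangent Is)) enormZ enorm_N // mulr1.
by rewrite gtr0_norm // curvature_gt0.
Qed.

Lemma arcD_indicatrix s X dX : I s -> is_derive s 1 X dX ->
  arcD T X s = (k s)^-1 *: dX.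
Proof. by move=> Is dXs; rewrite /arcD indicatrix_speed // (derive1_val dXs). Qed.

Lemma indicatrix_tangent s : I s -> tangent T s = N s.
Proof.
move=> Is; rewrite /tangent (arcD_indicatrix Is (is_derive_tangent Is)).
by rewrite scalerA mulVf ?scale1r // k_neq0.
Qed.

Lemma arcD_indicatrix_tangent s : I s ->
  arcD T (tangent T) s = - 1 *: T s + f s *: B s.
Proof.
move=> Is.
have dN : is_derive s 1 (tangent T) (- k s *: T s + t s *: B s).
  apply: (eq_on_is_derive I_open Is _ (is_derive_pnormal Is)) => x Ix.
  by rewrite indicatrix_tangent.
rewrite (arcD_indicatrix Is dN) scalerDr !scalerA mulrN mulVf ?k_neq0 //.
by rewrite [_ * t s]mulrC.
Qed.

Lemma indicatrix_curvatureE s : I s -> curvature T s = w s.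
Proof.
move=> Is; rewrite /curvature arcD_indicatrix_tangent // /enorm dotv_comb2.
rewrite dotv_TT // dotv_TB dotv_BB //; congr Num.sqrt.
by rewrite mulr0 addr0 !mulr1 mulrNN mulr1 -expr2.
Qed.

Lemma indicatrix_binormal s : I s ->
  binormal T s = (w s)^-1 *: (f s *: T s + B s).
Proof.
move=> Is; rewrite {1}/binormal indicatrix_tangent // /pnormal.
rewrite indicatrix_curvatureE // arcD_indicatrix_tangent // crossvZr.
rewrite -[B s]/(crossv (T s) (N s)) crossv_crossv_right dotv_NN // dotv_TN //.
by rewrite opprK !scale1r scale0r subr0 addrC.
Qed.

(** By the Frenet formulas the N-component of (f T + B)' cancels, as
    f kappa = tau; the derivative is along T - f B, which is orthogonal to
    f T + B as it must be. *)
Lemma is_derive_indicatrix_binormal s : I s ->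
  is_derive s 1 (binormal T) (sigma s * k s *: (T s - f s *: B s)).
Proof.
move=> Is; have w0 := indicatrix_curvature_gt0 s.
have [df _] := harmonic_curvature_C1 Is.
have dw := is_deriveV (lt0r_neq0 w0) (is_derive_indicatrix_curvature Is).
have := is_derive_scale dw (is_deriveD (is_derive_scale df (is_derive_tangent Is))
          (is_derive_binormal Is)).
have k0 := curvature_gt0 Is.
move=> d; apply: (@eq_on_is_derive _ _ I (fun x => (w x)^-1 *: (f x *: T x + B x))) => //.
  by move=> x Ix; rewrite indicatrix_binormal.
apply: (is_derive_eq d).
have tE : t s = f s * k s by rewrite /harmonic_curvature divfK ?gt_eqF.
(* The identity w^2 = 1 + f^2 enters only through this rewriting. *)
have wV : (w s)^-1 = (1 + f s ^+ 2) / w s ^+ 3.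
  by rewrite -indicatrix_curvature_sqr; field; rewrite gt_eqF.
rewrite [X in _ + X *: _]wV tE /slant_sigma /GRing.scale /= !fctE.
move: (T s) (N s) (B s) (derive1 f s) (f s) (w s) (k s) w0 k0 => T' N' B' df' f' w' k' w0 k0.
apply/rowP => i; rewrite !mxE.
by field; rewrite !gt_eqF.
Qed.

(** |T - f B| = w, and w is also the curvature |D T1| of the indicatrix. *)
Lemma ratio_slant_sigma s : I s ->
  enorm (arcD T (binormal T) s) / enorm (arcD T (tangent T) s) = `|sigma s|.
Proof.
move=> Is; have k0 := curvature_gt0 Is; have w0 := indicatrix_curvature_gt0 s.
rewrite -[enorm (arcD T (tangent T) s)]/(curvature T s) indicatrix_curvatureE //.
rewrite (arcD_indicatrix Is (is_derive_indicatrix_binormal Is)) scalerA enormZ.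
have -> : enorm (T s - f s *: B s) = w s.
  rewrite -[T s]scale1r -scaleNr /enorm dotv_comb2 dotv_TT // dotv_TB dotv_BB //.
  by congr Num.sqrt; rewrite mulr0 addr0 !mulr1 mulrNN -expr2.
by rewrite mulfK ?gt_eqF // mulrC mulfK // gt_eqF.
Qed.

(** * Slant helices and constancy of sigma *)

Lemma frenet_parseval s (u : 'rV[R]_3) : I s ->
  dotv u u = dotv (T s) u ^+ 2 + dotv (N s) u ^+ 2 + dotv (B s) u ^+ 2.
Proof.
move=> Is.
rewrite (frame_parseval u (dotv_TT Is) (dotv_NN Is) (dotv_TN Is)).
by rewrite !(dotvC u).
Qed.

(** If N.u = a is constant, N'.u = 0 gives T.u = f B.u. Differentiating this
    yields f' (B.u) = kappa a (1 + f^2), that is sigma w (B.u) = a, while the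
    decomposition of u in the Frenet frame gives |u|^2 = a^2 + w^2 (B.u)^2. The
    denominator is nonzero: otherwise B.u = 0, hence a = 0 and u = 0. *)
Lemma slant_of_constant_projection (u : 'rV[R]_3) a : u != 0 ->
  (forall s, I s -> dotv (N s) u = a) ->
  forall s, I s -> sigma s ^+ 2 = a ^+ 2 / (dotv u u - a ^+ 2).
Proof.
move=> u0 Nu s Is.
have k0 := curvature_gt0 Is; have w0 := indicatrix_curvature_gt0 s.
have [df _] := harmonic_curvature_C1 Is.
have Tu x : I x -> dotv (T x) u = f x * dotv (B x) u.
  move=> Ix; have kx0 := k_neq0 Ix.
  have := is_derive_cst_on Ix Nu (is_derive_dotvl u (is_derive_pnormal Ix)).
  rewrite dotvDl !dotvZl mulNr addrC => /eqP; rewrite subr_eq0 => /eqP e.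
  by rewrite /harmonic_curvature mulrAC e mulrAC divff // mul1r.
have key : derive1 f s * dotv (B s) u = k s * a * w s ^+ 2.
  have d1 := is_derive_dotvl u (is_derive_tangent Is).
  have d2 := is_deriveM df (is_derive_dotvl u (is_derive_binormal Is)).
  have := derive1_val (eq_on_is_derive I_open Is Tu d1).
  rewrite (derive1_val d2) (dotvZl (k s)) (dotvZl (- t s)) Nu //.
  rewrite indicatrix_curvature_sqr /GRing.scale /=.
  have -> : t s = f s * k s by rewrite /harmonic_curvature divfK ?gt_eqF.
  by lra.
have sb : sigma s * w s * dotv (B s) u = a.
  rewrite /slant_sigma; transitivity (derive1 f s * dotv (B s) u / (k s * w s ^+ 2)).
    by field; rewrite !gt_eqF.
  by rewrite key; field; rewrite !gt_eqF.
have ub : dotv u u - a ^+ 2 = w s ^+ 2 * dotv (B s) u ^+ 2.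
  by rewrite (frenet_parseval u Is) Nu // Tu // indicatrix_curvature_sqr; ring.
have D0 : dotv u u - a ^+ 2 != 0.
  apply: contra u0; rewrite ub => D0; rewrite -enorm_eq0 -sqrf_eq0 enorm_sqr.
  move: D0 sb; rewrite mulf_eq0 !sqrf_eq0 gt_eqF //= => /eqP b0.
  rewrite b0 mulr0 => a0; move: ub; rewrite -a0 b0.
  by rewrite expr0n /= mulr0 subr0 => ->.
by apply: (canRL (mulfK D0)); rewrite ub -sb; ring.
Qed.

Lemma slant_helix_sigma_cst : slant_helix I c ->
  exists a, forall s, I s -> sigma s ^+ 2 = a.
Proof.
move=> [_ [u [u0 [theta Nu]]]].
eexists; apply: (slant_of_constant_projection u0 (a := enorm u * cos theta)) => s Is.
by rewrite angle_cos Nu // enorm_N // mul1r.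
Qed.

(** The axis is B1 + m N: its derivative is
    sigma kappa (T - f B) + m kappa (- T + f B) = 0, and its N-component is m. *)
Lemma sigma_cst_slant_helix m : is_interval I ->
  (forall s, I s -> sigma s = m) -> slant_helix I c.
Proof.
move=> Iitv sm; split=> //.
have [[s0 Is0]|nI] := pselect (exists s, I s); last first.
  (* On an empty I any axis works. *)
  exists (const_mx 1); split; last by exists 0 => s Is; case: nI; exists s.
  by apply/eqP => /rowP /(_ 0); rewrite !mxE => /eqP; rewrite oner_eq0.
pose X x := binormal T x + m *: N x.
have dX s : I s -> is_derive s 1 X 0.
  move=> Is.
  have d := is_derive_scale (is_derive_cst m s 1) (is_derive_pnormal Is).
  apply: (is_derive_eq (is_deriveD (is_derive_indicatrix_binormal Is) d)).
  have tE : t s = f s * k s by rewrite /harmonic_curvature divfK // k_neq0.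
  rewrite sm // tE -[cst m s]/m; move: (N s) (T s) (B s) => N' T' B'.
  by apply/rowP => i; rewrite !mxE; ring.
have cX s : I s -> X s0 = X s by move=> Is; exact: (cst_on_interval Iitv dX).
have NX s : I s -> dotv (N s) (X s) = m.
  move=> Is; rewrite /X indicatrix_binormal // dotvC dotvDl (dotvZl m) dotv_NN //.
  rewrite (dotvZl (w s)^-1) dotvDl (dotvZl (f s)) dotv_TN // [dotv (B s) _]dotvC dotv_NB.
  by rewrite mulr0 addr0 mulr0 add0r mulr1.
have BX : dotv (X s0) (B s0) = (w s0)^-1.
  rewrite /X indicatrix_binormal // dotvDl (dotvZl m) dotv_NB (dotvZl (w s0)^-1) dotvDl (dotvZl (f s0)).
  by rewrite dotv_TB dotv_BB // !mulr0 add0r addr0 mulr1.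
exists (X s0); split.
  apply/eqP => X0; move: BX; rewrite X0 dotvE !mxE !mul0r !addr0 => /esym/eqP.
  by rewrite invr_eq0 gt_eqF // indicatrix_curvature_gt0.
exists (acos (m / enorm (X s0))) => s Is.
by rewrite /angle enorm_N // mul1r {1}(cX _ Is) NX.
Qed.
End Frenet.

Theorem theorem9 (R : realType) (I : set R) (alpha : R -> 'rV[R]_3)
    (I_open : open I) (I_itv : is_interval I)
    (alpha_smooth : smooth_on I alpha)
    (alpha_unit : unit_speed_on I alpha)
    (curvature_neq0 : forall s, I s -> curvature alpha s != 0)
    (torsion_neq0 : forall s, I s -> torsion alpha s != 0) :
  let Ttilde := tangent_indicatrix alpha in
  let T1 := tangent Ttilde in
  let B1 := binormal Ttilde in
  slant_helix I alpha <->
  constant_on I (fun s => enorm (arcD Ttilde B1 s) / enorm (arcD Ttilde T1 s)).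
Proof.
move=> Ttilde T1 B1.
have ratioE := ratio_slant_sigma I_open alpha_smooth alpha_unit curvature_neq0.
split=> [sh|[m rm]].
  have [a sa] := slant_helix_sigma_cst I_open alpha_smooth alpha_unit curvature_neq0 sh.
  by exists (Num.sqrt a) => s Is; rewrite /= ratioE // -sqrtr_sqr sa.
have sm s : I s -> `|slant_sigma alpha s| = m by move=> Is; rewrite -ratioE // rm.
have scst := cst_of_cst_norm I_itv
  (@continuous_slant_sigma _ _ _ I_open alpha_smooth alpha_unit curvature_neq0) sm.
have sh m' := @sigma_cst_slant_helix _ _ _ I_open alpha_smooth alpha_unit curvature_neq0 m' I_itv.
have [[s0 Is0]|nI] := pselect (exists s, I s).
  by apply: (sh (slant_sigma alpha s0)) => s Is; exact: scst.
by apply: (sh 0) => s Is; case: nI; exists s.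
Qed.
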